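(* Let $G=(V,\mathcal D,\mathcal B)$ be an acyclic directed mixed graph and let $a\to b\in\mathcal D$. Then $\lambda_{ab}$ is regression identifiable if and only if (i) $a\notin\operatorname{dis}_{\operatorname{an}(b)}(b)$, and (ii) there is no directed edge $a\to d$ for any $d\in\operatorname{dis}_{\operatorname{an}(b)}(b)\setminus\{b\}$. In particular, in that case $\lambda_{ab}=\beta_{ab\cdot S(b)\setminus\{a\}}$ where $S(b)=\operatorname{mb}_{\operatorname{an}(b)}(b)$.
   Context: An acyclic directed mixed graph (ADMG) $G=(V,\mathcal D,\mathcal B)$ has a finite vertex set $V$, a set $\mathcal D$ of directed edges and a set $\mathcal B$ of bidirected edges, with no loops and no directed cycles; a pair of vertices may be joined by both a directed and a bidirected edge. The parameters of the linear structural equation model of $G$ are pairs $(\Lambda,\Omega)$ where $\Lambda=(\lambda_{ij})\in\mathbb R^{V\times V}$ has $\lambda_{ij}=0$ unless $i\to j\in\mathcal D$, and $\Omega=(\omega_{ij})$ is symmetric positive definite with $\omega_{ij}=0$ unless $i=j$ or $i\leftrightarrow j\in\mathcal B$. The covariance matrix is $\Sigma=(\sigma_{ij})=(I-\Lambda)^{-T}\Omega(I-\Lambda)^{-1}$. $\operatorname{pa}(v)$ is the set of parents of $v$; $\operatorname{an}(v)$ is the set of ancestors of $v$ (via directed paths), including $v$. For a set, $\operatorname{pa}(S)=\bigcup_{v\in S}\operatorname{pa}(v)$. $G_W$ is the induced subgraph on $W\subseteq V$. The district $\operatorname{dis}(v)$ is the set of vertices connected to $v$ by a path of bidirected edges (including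 $v$). The Markov blanket is $\operatorname{mb}(v)=\operatorname{pa}(\operatorname{dis}(v))\cup(\operatorname{dis}(v)\setminus\{v\})$. $\operatorname{dis}_S(v)$ and $\operatorname{mb}_S(v)$ denote the district and Markov blanket of $v$ computed in $G_S$. $\beta_{vw\cdot S}=\sigma_{vw\cdot S}/\sigma_{vv\cdot S}$, where $\sigma_{vw\cdot S}=\sigma_{vw}-\Sigma_{vS}\Sigma_{SS}^{-1}\Sigma_{Sw}$. The coefficient $\lambda_{vw}$ of a directed edge $v\to w$ is regression identifiable if there is a set $S\subseteq V\setminus\{v,w\}$ such that $\lambda_{vw}=\beta_{vw\cdot S}$ for all parameters $(\Lambda,\Omega)$. *)

(* Defs.v *)
From mathcomp Require Import all_boot all_order all_algebra.
From mathcomp Require Import reals.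

Set Implicit Arguments.
Unset Strict Implicit.
Unset Printing Implicit Defensive.

Import Order.TTheory GRing.Theory Num.Theory.

Local Open Scope ring_scope.

(* [cycle e [:: v]] is [e v v], so [admg_acyclic] also excludes directed
   loops. *)
Record admg (V : finType) : Type := Admg {
  dir : rel V;
  bi : rel V;
  bi_sym : symmetric bi;
  bi_irr : irreflexive bi;
  admg_acyclic : forall p : seq V, cycle dir p -> p = [::]
}.

Section Graph.

Variable V : finType.
Implicit Types (G : admg V) (W S : {set V}) (u v w : V).

Definition restrict_rel W (e : rel V) : rel V :=
  [rel v w | [&& v \in W, w \in W & e v w]].

Lemma restrict_rel_sym W (e : rel V) :
  symmetric e -> symmetric (restrict_rel W e).
Proof. by move=> es v w; rewrite /restrict_rel /= andbCA es. Qed.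

Lemma restrict_rel_irr W (e : rel V) :
  irreflexive e -> irreflexive (restrict_rel W e).
Proof. by move=> ei v; rewrite /restrict_rel /= ei !andbF. Qed.

Lemma restrict_rel_acyclic W (e : rel V) :
  (forall p : seq V, cycle e p -> p = [::]) ->
  forall p : seq V, cycle (restrict_rel W e) p -> p = [::].
Proof.
move=> ac p cp; apply: ac; apply: sub_cycle cp => v w.
by case/and3P.
Qed.

(* The induced subgraph G_W. It is kept on the vertex type V: vertices outside
   W are isolated, which does not affect districts and Markov blankets of the
   vertices of W. *)
Definition induced G W : admg V :=
  Admg (restrict_rel_sym W (@bi_sym _ G))
       (restrict_rel_irr W (@bi_irr _ G))
       (@restrict_rel_acyclic W _ (@admg_acyclic _ G)).

Definition pa G v : {set V} := [set u | dir G u v].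

Definition pa_set G S : {set V} := \bigcup_(v in S) pa G v.

(* [connect] is reflexive, so v belongs to [an G v] and to [dis G v]. *)
Definition an G v : {set V} := [set u | connect (dir G) u v].

Definition dis G v : {set V} := [set u | connect (bi G) v u].

Definition mb G v : {set V} := pa_set G (dis G v) :|: (dis G v :\ v).

Definition dis_in G W v : {set V} := dis (induced G W) v.

Definition mb_in G W v : {set V} := mb (induced G W) v.

End Graph.

Definition posdef (R : realType) (n : nat) (A : 'M[R]_n) : Prop :=
  A^T = A /\ forall x : 'cV[R]_n, x != 0 -> 0 < (x^T *m A *m x) 0 0.

Section Model.

Variables (R : realType) (V : finType).
Implicit Types (G : admg V) (L Om Sigma : 'M[R]_#|V|) (S : {set V}) (v w : V).

(* The V x V matrices are indexed by 'I_#|V|, along [enum_rank]. *)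
Definition entry (A : 'M[R]_#|V|) v w : R := A (enum_rank v) (enum_rank w).

Definition sem_params G L Om : Prop :=
  [/\ forall v w, ~~ dir G v w -> entry L v w = 0,
      posdef Om
    & forall v w, v != w -> ~~ bi G v w -> entry Om v w = 0].

Definition covariance L Om : 'M[R]_#|V| :=
  (invmx (1%:M - L))^T *m Om *m invmx (1%:M - L).

(* sigma_{vw.S}; for S empty the matrix product ranges over 'I_0 and is 0. *)
Definition cond_cov Sigma v w S : R :=
  entry Sigma v w -
  ((\row_(j < #|S|) entry Sigma v (enum_val j))
     *m invmx (\matrix_(i < #|S|, j < #|S|)
                 entry Sigma (enum_val i) (enum_val j))
     *m (\col_(i < #|S|) entry Sigma (enum_val i) w)) 0 0.

Definition regr_coef Sigma v w S : R :=
  cond_cov Sigma v w S / cond_cov Sigma v v S.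

Definition equals_regr_coef G v w S : Prop :=
  forall L Om, sem_params G L Om ->
    entry L v w = regr_coef (covariance L Om) v w S.

Definition regression_identifiable G v w : Prop :=
  exists2 S : {set V}, S \subset ~: [set v; w] & equals_regr_coef G v w S.

End Model.

Arguments equals_regr_coef R {V} G v w S.
Arguments regression_identifiable R {V} G v w.

(* Main.v *)
Require Import Defs.
From mathcomp Require Import all_boot all_order all_algebra.
From mathcomp Require Import reals.
From mathcomp Require Import ring lra.

(** Write [B = I - L], so that [B^T Sigma B = Om], and let [A] be the set of
    ancestors of [b] and [D] the district of [b] in [G_A].

    Sufficiency: let [g] be the residual of the regression of the error of [b]
    on the errors of [D \ b].  It is uncorrelated with every error of
    [A \ b], hence [B g] is orthogonal to [X_v] for every [v] in [A \ b].
    [B g] is supported on [b] and its Markov blanket, so it is the residual of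
    the regression of [X_b] on that blanket, and under (i) and (ii) its
    coefficient at [a] is [- lambda_ab].

    Necessity: take [lambda_ab = 0], let every vertex of [A] outside
    [a, b, S] pass its full value to one chosen child in [A], and take all
    bidirected entries of [Om] negative.  If [beta_ab.S] vanished, the residual
    of [X_b] on [X_S] would be orthogonal to [X_a] too.  Let [w] be its
    vector of weights on the errors.  An M-matrix argument (first test against
    the negative part of [w], then against the indicator of its zero set in
    [A]) shows that [w >= 0] and that [w > 0] on [D].  If [a] is in [D], then
    [w a = 0] is a contradiction; if [a -> d] with [d] in [D \ b], giving
    this edge the coefficient -1 forces [w a = - w d < 0]. *)

(** * Induction on acyclic relations *)

Section Acyclic.

Set Implicit Arguments.
Unset Strict Implicit.

Variables (V : finType) (e : rel V).
Hypothesis e_acyclic : forall p : seq V, cycle e p -> p = [::].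

Lemma acyclic_connect u v : e u v -> connect e v u = false.
Proof.
move=> euv; apply/negP => /connectP [p vp lp].
have : cycle e (v :: p) by rewrite /= rcons_path vp -lp.
by move/e_acyclic.
Qed.

(** The number of vertices reachable from [v] drops along each edge, since [v] is not reachable from
    its successors. *)
Lemma acyclic_ind (P : V -> Prop) :
  (forall v, (forall w, e v w -> P w) -> P v) -> forall v, P v.
Proof.
move=> IH v; have [n] := ubnP #|[set u | connect e v u]|.
elim: n v => // n IHn v; rewrite ltnS => le_n; apply: IH => w evw.
apply: IHn; apply: leq_trans le_n; apply/proper_card/properP; split.
  by apply/subsetP => u; rewrite !inE; apply: connect_trans (connect1 evw).
by exists v; rewrite inE ?connect0 // acyclic_connect.
Qed.

Lemma acyclic_rev (p : seq V) : cycle (fun u v => e v u) p -> p = [::].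
Proof.
rewrite -rev_cycle => /e_acyclic p0.
by apply/nilP; rewrite /nilp -size_rev p0.
Qed.

End Acyclic.

(** * Matrices acting on functions on [V], and linear regression *)

Section LinearAlgebra.

Set Implicit Arguments.
Unset Strict Implicit.
Import Order.TTheory GRing.Theory Num.Theory.
Local Open Scope ring_scope.

Lemma unitmx_inj (F : fieldType) n (A : 'M[F]_n) :
  (forall x : 'cV_n, A *m x = 0 -> x = 0) -> A \in unitmx.
Proof.
move=> injA; rewrite -unitmx_tr -row_free_unit; apply: inj_row_free => x xA0.
have /injA xT0 : A *m x^T = 0 by rewrite -[A]trmxK -trmx_mul xA0 trmx0.
by rewrite -[x]trmxK xT0 trmx0.
Qed.

Variables (R : realType) (V : finType).
Implicit Types (A B M : 'M[R]_#|V|) (x y : V -> R) (v w : V) (S : {set V}).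

(** Vectors are functions on [V], which keeps the enumeration behind matrix indices out of the graph
    arguments. *)
Definition app A x v : R := \sum_u entry A v u * x u.

Definition colv x : 'cV[R]_#|V| := \col_i x (enum_val i).

Definition mx_of (f : V -> V -> R) : 'M[R]_#|V| :=
  \matrix_(i, j) f (enum_val i) (enum_val j).

Lemma entry_mx_of f v w : entry (mx_of f) v w = f v w.
Proof. by rewrite /entry mxE !enum_rankK. Qed.

Lemma sum_enum_rank (F : 'I_#|V| -> R) :
  \sum_i F i = \sum_v F (enum_rank v).
Proof. by rewrite (reindex enum_rank) //; apply/onW_bij/enum_rank_bij. Qed.

Lemma mulmx_colv A x : A *m colv x = colv (app A x).
Proof.
apply/colP => i; rewrite !mxE sum_enum_rank; apply: eq_bigr => u _.
by rewrite mxE enum_rankK /entry enum_valK.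
Qed.

Lemma colvK (z : 'cV[R]_#|V|) : colv (fun v => z (enum_rank v) 0) = z.
Proof. by apply/colP => i; rewrite mxE enum_valK. Qed.

Lemma colv_inj x y : colv x = colv y -> x =1 y.
Proof. by move/colP => xy v; have:= xy (enum_rank v); rewrite !mxE enum_rankK. Qed.

Lemma colv0 x : (forall v, x v = 0) -> colv x = 0.
Proof. by move=> x0; apply/colP => i; rewrite !mxE. Qed.

Lemma app_mul A B x v : app (A *m B) x v = app A (app B x) v.
Proof. by apply: colv_inj v; rewrite -!mulmx_colv mulmxA. Qed.

Lemma app1 x v : app 1%:M x v = x v.
Proof. by apply: colv_inj v; rewrite -mulmx_colv mul1mx. Qed.

Lemma eq_app A x y : x =1 y -> app A x =1 app A y.
Proof. by move=> xy v; apply: eq_bigr => u _; rewrite xy. Qed.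

Lemma app0 A x v : (forall u, x u = 0) -> app A x v = 0.
Proof. by move=> x0; apply: big1 => u _; rewrite x0 mulr0. Qed.

Lemma app_subl A B x v : app (A - B) x v = app A x v - app B x v.
Proof.
rewrite /app -sumrB; apply: eq_bigr => u _.
by rewrite /entry !mxE mulrBl.
Qed.

Lemma dot_app A x y :
  \sum_v x v * app A y v = \sum_v app A^T x v * y v.
Proof.
under eq_bigr do rewrite big_distrr /=.
rewrite exchange_big; apply: eq_bigr => u _.
rewrite big_distrl; apply: eq_bigr => v _ /=.
by rewrite /entry mxE mulrCA mulrA.
Qed.

Lemma form_colv A x :
  ((colv x)^T *m A *m colv x) 0 0 = \sum_v x v * app A x v.
Proof.
rewrite -mulmxA mulmx_colv mxE sum_enum_rank; apply: eq_bigr => v _.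
by rewrite !mxE enum_rankK.
Qed.

Lemma posdef_eq0 A x : posdef A ->
  \sum_v x v * app A x v <= 0 -> forall v, x v = 0.
Proof.
case=> _ pA; rewrite -form_colv leNgt => /negP le0 v.
have [x0|/pA //] := eqVneq (colv x) 0.
by have /colP /(_ (enum_rank v)) := x0; rewrite !mxE enum_rankK.
Qed.

Lemma posdefI A : A^T = A ->
  (forall x, \sum_v x v * app A x v <= 0 -> forall v, x v = 0) -> posdef A.
Proof.
move=> symA pA; split=> // z; rewrite -[z]colvK form_colv => nz.
rewrite ltNge; apply: contra nz => /pA x0.
by apply/eqP/colv0.
Qed.

Definition indic v u : R := (u == v)%:R.

Lemma app_indic A v w : app A (indic w) v = entry A v w.
Proof.
rewrite /app (bigD1 w) //= /indic eqxx mulr1 big1 ?addr0 // => u /negPf ->.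
by rewrite mulr0.
Qed.

Lemma app_lin A (k : R) x y v :
  app A (fun u => x u + k * y u) v = app A x v + k * app A y v.
Proof.
rewrite /app big_distrr -big_split /=; apply: eq_bigr => u _.
by rewrite mulrDr mulrCA.
Qed.

Lemma app_sub A x y v : app A (fun u => x u - y u) v = app A x v - app A y v.
Proof.
by rewrite /app -sumrB; apply: eq_bigr => u _; rewrite mulrBr.
Qed.

Definition ext0 S (z : 'cV[R]_#|S|) v : R := \sum_(i | enum_val i == v) z i 0.

Lemma ext0_val S (z : 'cV[R]_#|S|) i : ext0 z (enum_val i) = z i 0.
Proof.
by rewrite /ext0 (big_pred1 i) // => j; rewrite /= (inj_eq enum_val_inj).
Qed.

Lemma ext0_out S (z : 'cV[R]_#|S|) v : v \notin S -> ext0 z v = 0.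
Proof.
by move=> vS; apply: big1 => i /eqP iv; rewrite -iv enum_valP in vS.
Qed.

Lemma sum_ext0 S (z : 'cV[R]_#|S|) (f : V -> R) :
  \sum_v f v * ext0 z v = \sum_i f (enum_val i) * z i 0.
Proof.
rewrite (partition_big (@enum_val V [in S]) xpredT) //=.
apply: eq_bigr => v _; rewrite /ext0 big_distrr /=.
by apply: eq_bigr => i /eqP ->.
Qed.

(** [y] holds the coefficients of the regression of [w] on [S], extended by zero, so that later
    proofs use normal equations on [V] instead of the inverse of a submatrix. *)
Lemma regression M S w : posdef M -> exists y,
  [/\ forall v, v \notin S -> y v = 0,
      forall s, s \in S -> app M y s = entry M s w
    & forall v, cond_cov M v w S = entry M v w - app M y v].
Proof.
move=> pM.
pose C := \matrix_(i < #|S|, j < #|S|) entry M (enum_val i) (enum_val j).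
pose r := \col_(i < #|S|) entry M (enum_val i) w.
have CE (z : 'cV_#|S|) i : (C *m z) i 0 = app M (ext0 z) (enum_val i).
  rewrite /app sum_ext0 mxE; apply: eq_bigr => j _.
  by rewrite mxE.
have uC : C \in unitmx.
  apply: unitmx_inj => z Cz0; apply/colP => i; rewrite mxE -ext0_val.
  apply: (posdef_eq0 pM).
  under eq_bigr do rewrite mulrC.
  rewrite sum_ext0 big1 // => j _.
  by rewrite -CE Cz0 mxE mul0r.
exists (ext0 (invmx C *m r)); split=> [v|s sS|v]; first exact: ext0_out.
  by rewrite -(enum_rankK_in sS sS) -CE mulKVmx // mxE.
congr (_ - _); rewrite -mulmxA mxE /app sum_ext0; apply: eq_bigr => i _.
by rewrite mxE.
Qed.

(** This conditional variance is the quadratic form of [M] at the residual [indic v - y], which is 1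
    at [v]. *)
Lemma cond_var_gt0 M S v : posdef M -> v \notin S -> 0 < cond_cov M v v S.
Proof.
move=> pM vS; have [y [y0 yS ->]] := regression S v pM.
pose x u := indic v u - y u.
have xE u : app M x u = entry M u v - app M y u by rewrite app_sub app_indic.
have form : \sum_u x u * app M x u = entry M v v - app M y v.
  rewrite (bigD1 v) //= big1 ?addr0 => [|u uv].
    by rewrite xE /x /indic eqxx y0 // subr0 mul1r.
  have [uS|uS] := boolP (u \in S); first by rewrite xE yS // subrr mulr0.
  by rewrite /x /indic (negPf uv) y0 // subrr mul0r.
rewrite ltNge; apply/negP; rewrite -form => /(posdef_eq0 pM)/(_ v)/eqP.
by rewrite /x /indic eqxx y0 // subr0 oner_eq0.
Qed.

(** Frisch-Waugh-Lovell: a coefficient of the joint regression on [v |: S] is obtained by first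
    regressing [v] and [w] on [S]. *)
Lemma regr_coefE M S v w (c : V -> R) : posdef M -> v \notin S ->
  (forall u, u \notin v |: S -> c u = 0) ->
  (forall s, s \in v |: S -> app M c s = entry M s w) ->
  regr_coef M v w S = c v.
Proof.
move=> pM vS c0 cS; have := cond_var_gt0 pM vS; rewrite /regr_coef.
have [y [y0 yS ->]] := regression S w pM.
have [z [z0 zS ->]] := regression S v pM.
(* [f] is supported on [S] and solves the homogeneous normal equations there, so it is zero; its
   image at [v] then relates the two conditional covariances. *)
pose f u := c u - y u + (- c v) * (indic v u - z u).
have fE u : app M f u
    = app M c u - app M y u + (- c v) * (entry M u v - app M z u).
  by rewrite app_lin !app_sub app_indic.
have f0 : forall u, f u = 0.
  apply: (posdef_eq0 pM); rewrite big1 // => u _.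
  have [uS|uS] := boolP (u \in S).
    by rewrite fE yS // zS // cS ?inE ?uS ?orbT // !subrr mulr0 addr0 mulr0.
  rewrite /f y0 // z0 // /indic; have [->|uv] := eqVneq u v.
    by rewrite !subr0 mulr1 subrr mul0r.
  by rewrite c0 ?inE ?negb_or ?uv // !subr0 mulr0 addr0 mul0r.
have := fE v; rewrite (app0 _ _ f0) cS ?inE ?eqxx // => fv pos.
apply: (mulIf (lt0r_neq0 pos)); rewrite divfK ?lt0r_neq0 //.
lra.
Qed.

End LinearAlgebra.

(** * Ancestors, districts and the covariance matrix *)

Section Model.

Set Implicit Arguments.
Unset Strict Implicit.
Import Order.TTheory GRing.Theory Num.Theory.
Local Open Scope ring_scope.

Variables (R : realType) (V : finType) (G : admg V).
Implicit Types (L Om : 'M[R]_#|V|) (x y g : V -> R) (a b u v w : V) (S W : {set V}).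

Let acyc := @admg_acyclic _ G.

Lemma an_pa b u v : v \in an G b -> dir G u v -> u \in an G b.
Proof. by rewrite !inE => vb uv; apply: connect_trans vb; apply: connect1. Qed.

Lemma an_self b : b \in an G b.
Proof. by rewrite inE connect0. Qed.

Lemma an_dirN b v : v \in an G b -> dir G b v = false.
Proof.
by rewrite inE => vb; apply/negP => /(acyclic_connect acyc); rewrite vb.
Qed.

Lemma an_child b v : v \in an G b -> v != b ->
  exists2 u, u \in an G b & dir G v u.
Proof.
rewrite inE => /connectP [[|u p] /=]; first by move=> _ ->; rewrite eqxx.
by case/andP=> vu up -> _; exists u => //; rewrite inE; apply/connectP; exists p.
Qed.

Lemma dis_in_sub W b v : b \in W -> v \in dis_in G W b -> v \in W.
Proof.
move=> bW; rewrite inE => bv; rewrite -(@closed_connect _ _ _ _ _ _ bv) //.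
by move=> u t /and3P [-> ->].
Qed.

Lemma dis_in_self W b : b \in dis_in G W b.
Proof. by rewrite inE connect0. Qed.

Lemma dis_in_bi W b u v : u \in W -> v \in W -> bi G u v ->
  u \in dis_in G W b -> v \in dis_in G W b.
Proof.
move=> uW vW uv; rewrite !inE => bu; apply: (connect_trans bu).
by apply: connect1; apply/and3P.
Qed.

(** Restricting to [an G b] loses no parent of the district, because ancestral sets are closed under
    parents. *)
Lemma mb_in_anP b u : reflect
  ((exists2 v, v \in dis_in G (an G b) b & dir G u v) \/
   u != b /\ u \in dis_in G (an G b) b)
  (u \in mb_in G (an G b) b).
Proof.
rewrite /mb_in /mb in_setU in_setD1; apply: (iffP orP) => -[].
- case/bigcupP=> v vD; rewrite inE => /and3P [_ _ uv]; by left; exists v.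
- by case/andP; right.
- case=> v vD uv; left; apply/bigcupP; exists v => //.
  have vA := dis_in_sub (an_self b) vD.
  by rewrite inE; apply/and3P; split=> //; apply: an_pa uv.
- by case=> ub uD; right; rewrite ub.
Qed.

(** A kernel vector at [v] is a combination of its values at the children of [v], so it vanishes by
    induction from the sinks. *)
Lemma one_sub_unitmx L :
  (forall v w, ~~ dir G v w -> entry L v w = 0) -> 1%:M - L \in unitmx.
Proof.
move=> L0; apply: unitmx_inj => z; rewrite -[z]colvK mulmx_colv.
set x := fun v => _ => Bx; apply: colv0; apply: (acyclic_ind acyc) => v IH.
have /colP/(_ (enum_rank v)) := Bx.
rewrite !mxE enum_rankK app_subl app1 /app big1 ?subr0 // => u _.
by have [/IH ->|/L0 ->] := boolP (dir G v u); rewrite ?mulr0 ?mul0r.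
Qed.

Lemma covarianceK L Om : 1%:M - L \in unitmx ->
  (1%:M - L)^T *m covariance L Om *m (1%:M - L) = Om.
Proof.
move=> uB; rewrite /covariance !mulmxA -trmx_mul mulVmx // trmx1 mul1mx.
by rewrite mulmxKV.
Qed.

(** Weights [g] on the errors and coefficients [app (1%:M - L) g] on the variables describe the same
    combination; both sides are its covariance with the error of [v]. *)
Lemma app_covariance L Om g v : 1%:M - L \in unitmx ->
  app (1%:M - L)^T (app (covariance L Om) (app (1%:M - L) g)) v = app Om g v.
Proof.
move=> uB; rewrite -[in RHS](covarianceK Om uB) -mulmxA app_mul.
by apply: eq_app => u; rewrite app_mul.
Qed.

Lemma posdef_covariance L Om : 1%:M - L \in unitmx ->
  posdef Om -> posdef (covariance L Om).
Proof.
move=> uB pOm; apply: posdefI.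
  by rewrite /covariance !trmx_mul trmxK pOm.1 mulmxA.
set B := 1%:M - L in uB *; move=> x le0.
pose g := app (invmx B) x.
have Bg v : app B g v = x v by rewrite -app_mul mulmxV // app1.
have g0 v : g v = 0.
  apply: (posdef_eq0 pOm); apply: le_trans le0.
  under eq_bigr do rewrite -(app_covariance Om g _ uB).
  rewrite (dot_app B^T) trmxK le_eqVlt; apply/orP; left; apply/eqP.
  apply: eq_bigr => u _; rewrite Bg; congr (_ * _); exact: eq_app.
by move=> v; rewrite -Bg app0.
Qed.

(** * Sufficiency: regression on the Markov blanket *)

Lemma regr_coef_mb a b : dir G a b ->
  a \notin dis_in G (an G b) b ->
  ~ (exists2 d, d \in dis_in G (an G b) b :\ b & dir G a d) ->
  equals_regr_coef R G a b (mb_in G (an G b) b :\ a).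
Proof.
set A := an G b; set D := dis_in G A b => ab aD aN L Om [L0 pOm Om0].
have bA : b \in A := an_self b.
have bD : b \in D := dis_in_self A b.
have DA v : v \in D -> v \in A := dis_in_sub bA.
have uB := one_sub_unitmx L0; have pS := posdef_covariance uB pOm.
set M := covariance L Om in pS *; set B := 1%:M - L in uB *.
have [y [y0 yS _]] := regression (D :\ b) b pOm.
pose g u := indic R b u - y u.
have gb : g b = 1 by rewrite /g /indic eqxx y0 ?subr0 // !inE eqxx.
have g0 v : v \notin D -> g v = 0.
  move=> vD; rewrite /g y0; last by rewrite in_setD1 (negPf vD) andbF.
  rewrite /indic subr0.
  by case: eqP vD => // ->; rewrite bD.
have Og v : v \in A -> v != b -> app Om g v = 0.
  move=> vA vb; have [vD|vD] := boolP (v \in D).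
    by rewrite app_sub app_indic yS ?subrr // in_setD1 vb.
  apply: big1 => u _; have [uD|/g0 ->] := boolP (u \in D); last exact: mulr0.
  rewrite Om0 ?mul0r //; first by apply: contraNneq vD => ->.
  apply: contra vD => uv; apply: (dis_in_bi (DA _ uD)) uD => //.
  by rewrite bi_sym.
pose x := app B g; have xE v : x v = g v - app L g v by rewrite /x app_subl app1.
pose h := app M x.
(* [h] lists the covariances of the residual with the variables. As [B^T h = Om g] is zero at [v],
   [h v] combines values at parents of [v], which lie in [A] and differ from [b]; hence an induction
   along reversed edges. *)
have h0 : forall v, v \in A -> v != b -> h v = 0.
  apply: (acyclic_ind (acyclic_rev acyc)) => v IH vA vb.
  have := app_covariance Om g v uB; rewrite -/B -/M -/x -/h (Og v vA vb).
  rewrite /B raddfB /= trmx1 app_subl app1 /app big1 ?subr0 // => u _.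
  have [uv|/L0 Luv] := boolP (dir G u v).
    rewrite IH ?mulr0 ?(an_pa vA uv) //.
    by apply: contraTneq uv => ->; rewrite an_dirN.
  by rewrite /entry mxE -/(entry L u v) Luv mul0r.
have Lg0 v : (forall u, u \in D -> ~~ dir G v u) -> app L g v = 0.
  move=> vN; apply: big1 => u _.
  have [uD|/g0 ->] := boolP (u \in D); last exact: mulr0.
  by rewrite L0 ?mul0r ?vN.
have aNb : a != b by apply: contraNneq aD => ->.
(* [x] is 1 at [b]; removing that entry and changing the sign turns the residual into regression
   coefficients. *)
rewrite (@regr_coefE _ _ M _ a b (fun u => indic R b u - x u)) //.
- rewrite xE /indic (negPf aNb) g0 // !sub0r opprK.
  rewrite /app (bigD1 b) //= gb mulr1 big1 ?addr0 // => u ub.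
  have [uD|/g0 ->] := boolP (u \in D); last exact: mulr0.
  rewrite L0 ?mul0r //; apply/negP => au; case: aN; exists u => //.
  by rewrite in_setD1 ub.
- by rewrite !inE eqxx.
- move=> u; rewrite in_setU1 in_setD1 negb_or => /andP [ua].
  rewrite ua /= => /mb_in_anP uN; rewrite xE /indic.
  have [->|ub] := eqVneq u b.
    rewrite gb Lg0 ?subr0 ?subrr // => v /DA vA.
    by rewrite an_dirN.
  rewrite g0 ?Lg0 ?subrr //.
    by move=> v vD; apply/negP => uv; apply: uN; left; exists v.
  by apply/negP => uD; apply: uN; right.
- move=> s sS; rewrite app_sub app_indic -/h h0 ?subr0 //.
    case/setU1P: sS => [->|]; first exact: an_pa bA ab.
    by case/setD1P=> _ /mb_in_anP [[v /DA vA /(an_pa vA)]|[_ /DA]].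
  case/setU1P: sS => [->|]; first exact: aNb.
  case/setD1P=> _ /mb_in_anP [[v /DA vA sv]|[]] //.
  by apply: contraTneq sv => ->; rewrite an_dirN.
Qed.

(** * Necessity: parameters with positive weights on the district *)

Lemma negative_posdef : exists Om, [/\ posdef Om,
  forall v w, v != w -> ~~ bi G v w -> entry Om v w = 0
  & forall v w, bi G v w -> entry Om v w < 0].
Proof.
(* [Om] is the identity minus [e] times the bidirected adjacency matrix. The form of the latter is
   at most [#|V|] times the squared norm, and this [e] leaves the margin [1 - e * #|V| = e]. *)
pose e : R := (#|V|.+1)%:R^-1.
have e0 : 0 < e by rewrite invr_gt0 ltr0n.
have eV : e * #|V|%:R = 1 - e.
  apply: (@addIr _ e); rewrite subrK -[X in _ + X]mulr1 -mulrDr natr1 mulVf //.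
  by rewrite pnatr_eq0.
pose f v w : R := (v == w)%:R - e * (bi G v w)%:R.
exists (mx_of f); split=> [|v w vw vwN|v w vw].
- apply: posdefI => [|x].
    apply/matrixP => i j; rewrite !mxE /f eq_sym bi_sym //.
  pose q := \sum_v x v ^+ 2.
  suff le_q : e * q <= \sum_v x v * app (mx_of f) x v.
    move=> /(le_trans le_q); rewrite pmulr_rle0 // => q0 v.
    apply/eqP; rewrite -sqrf_eq0; apply/eqP.
    have sq0 u : true -> 0 <= x u ^+ 2 by rewrite sqr_ge0.
    apply: (psumr_eq0P sq0) v isT.
    by apply/eqP; rewrite eq_le q0 sumr_ge0.
  have -> : \sum_v x v * app (mx_of f) x v
      = q - e * \sum_v \sum_u (bi G v u)%:R * (x v * x u).
    rewrite /q big_distrr -sumrB; apply: eq_bigr => v _ /=.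
    rewrite /app !big_distrr /= (bigD1 v) //= [in RHS](bigD1 v) //=.
    rewrite entry_mx_of /f eqxx bi_irr opprD addrA.
    congr (_ + _); first by rewrite !mulr0 mul0r mulr0 !subr0 mul1r expr2.
    rewrite -sumrN; apply: eq_bigr => u uv.
    rewrite entry_mx_of /f [v == u]eq_sym (negPf uv) sub0r; ring.
  have : \sum_v \sum_u (bi G v u)%:R * (x v * x u) <= #|V|%:R * q.
    apply: (@le_trans _ _ (\sum_v \sum_u (x v ^+ 2 / 2 + x u ^+ 2 / 2))).
      apply: ler_sum => v _; apply: ler_sum => u _.
      have := sqr_ge0 (x v - x u); have := sqr_ge0 (x v + x u).
      by case: (bi G v u); rewrite ?mul1r ?mul0r; nra.
    under eq_bigr do rewrite big_split /= sumr_const.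
    rewrite big_split /= sumr_const sumrMnl -!mulr_suml -/q.
    by rewrite -mulrnDl -splitr mulr_natl.
  move=> /(ler_wpM2l (ltW e0)); rewrite mulrA eV; lra.
- by rewrite entry_mx_of /f (negPf vw) (negPf vwN) mulr0 subrr.
- rewrite entry_mx_of /f vw; case: eqP vw => [->|_ _]; first by rewrite bi_irr.
  by rewrite mulr1 sub0r oppr_lt0.
Qed.

(* [k] is the row of [a] in the matrix [L] of the counterexample. *)
Lemma faithful_weights a b S (k : V -> R) : dir G a b ->
  S \subset ~: [set a; b] -> equals_regr_coef R G a b S ->
  (forall u, ~~ dir G a u -> k u = 0) -> k b = 0 ->
  exists w : V -> R, [/\ w a = \sum_u k u * w u, forall v, 0 <= w v
    & forall d, d \in dis_in G (an G b) b -> 0 < w d].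
Proof.
move=> ab Sab eqS k0 kb; set A := an G b.
have [Om [pOm Om0 Omlt]] := negative_posdef.
have Omle v u : v != u -> entry Om v u <= 0.
  by move=> vu; have [/Omlt/ltW|/(Om0 _ _ vu) ->] := boolP (bi G v u).
have bA : b \in A := an_self b.
have ba : b != a by apply: contraTneq ab => <-; rewrite an_dirN.
have aS : a \notin S.
  by apply/negP => /(subsetP Sab); rewrite !inE eqxx.
have bS : b \notin S.
  by apply/negP => /(subsetP Sab); rewrite !inE eqxx orbT.
pose nxt v := odflt v [pick u in A | dir G v u].
have nxtP v : v \in A -> v != b -> nxt v \in A /\ dir G v (nxt v).
  move=> vA vb; rewrite /nxt; case: pickP => [u /andP [] //|N].
  by have [u uA vu] := an_child vA vb; have := N u; rewrite uA vu.
pose inner v := (v \in A) && (v \notin b |: S).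
(* Row [a] is [k], an inner vertex passes its value to [nxt], and all other rows are zero. *)
pose f v u := if v == a then k u else
  if inner v then (u == nxt v)%:R else 0.
pose L := mx_of f; pose B := 1%:M - L; pose M := covariance L Om.
have L0 v u : ~~ dir G v u -> entry L v u = 0.
  rewrite entry_mx_of /f => vu; have [va|_] := eqVneq v a.
    by apply: k0; rewrite -va.
  case: ifP => // /andP [vA]; rewrite !inE negb_or => /andP [vb _].
  by case: eqP vu => // ->; rewrite (nxtP v vA vb).2.
have appLa x : app L x a = \sum_u k u * x u.
  by apply: eq_bigr => u _; rewrite entry_mx_of /f eqxx.
have appLi x v : v != a -> inner v -> app L x v = x (nxt v).
  move=> /negPf va iv; rewrite /app (bigD1 (nxt v)) //= big1 ?addr0.
    by rewrite entry_mx_of /f va iv eqxx mul1r.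
  by move=> u /negPf uv; rewrite entry_mx_of /f va iv uv mul0r.
have appLo x v : v != a -> ~~ inner v -> app L x v = 0.
  move=> /negPf va /negPf iv; apply: big1 => u _.
  by rewrite entry_mx_of /f va iv mul0r.
have uB : B \in unitmx := one_sub_unitmx L0.
have pM : posdef M := posdef_covariance uB pOm.
(* [k b = 0] gives the edge from [a] to [b] the coefficient 0, so the regression coefficient
   vanishes. *)
have cov0 : cond_cov M a b S = 0.
  have /eqP := eqS L Om (And3 L0 pOm Om0).
  rewrite entry_mx_of /f eqxx kb /regr_coef -/M eq_sym mulf_eq0 invr_eq0.
  by rewrite (gt_eqF (cond_var_gt0 pM aS)) orbF => /eqP.
have [y [y0 yS yM]] := regression S b pM.
pose x u := indic R b u - y u.
have Mx v : v \in a |: S -> app M x v = 0.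
  rewrite app_sub app_indic; case/setU1P => [->|/yS ->]; last exact: subrr.
  by rewrite -yM.
have x0 v : v != b -> v \notin S -> x v = 0.
  by move=> /negPf vb vS; rewrite /x /indic vb y0 // subrr.
pose w := app (invmx B) x.
have Bw v : app B w v = x v by rewrite -app_mul mulmxV // app1.
have wE v : w v = x v + app L w v.
  by rewrite -Bw app_subl app1 subrK.
have ib : ~~ inner b by rewrite /inner !inE eqxx /= andbF.
have wb : w b = 1 by rewrite wE appLo // /x /indic eqxx y0 // subr0 addr0.
have wa : w a = \sum_u k u * w u by rewrite wE x0 1?eq_sym // add0r appLa.
have wi v : v != a -> inner v -> w v = w (nxt v).
  move=> va iv; rewrite wE appLi // x0 ?add0r //.
    by case/andP: iv => _; rewrite in_setU1 negb_or => /andP [].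
  by case/andP: iv => _; rewrite in_setU1 negb_or => /andP [].
have wo v : v \notin a |: S -> v != b -> ~~ inner v -> w v = 0.
  rewrite in_setU1 negb_or => /andP [va vS] vb iv.
  by rewrite wE appLo // x0 // add0r.
(* [M x] vanishes on [a |: S], so [Om w] is orthogonal to every [p] with [B p] supported there. *)
have test p : (forall v, v \notin a |: S -> app B p v = 0) ->
    \sum_v p v * app Om w v = 0.
  move=> Bp; under eq_bigr do rewrite -(app_covariance Om w _ uB).
  rewrite dot_app trmxK big1 // => v _.
  have [vS|/Bp ->] := boolP (v \in a |: S); last exact: mul0r.
  by rewrite (eq_app _ Bw) -/M Mx // mulr0.
(* These conditions make [B p] vanish off [a |: S]. The last two hold for [w], hence for any
   pointwise function of [w] that fixes 0. *)
have testE p : p b = 0 ->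
    (forall v, v != a -> inner v -> p v = p (nxt v)) ->
    (forall v, v \notin a |: S -> v != b -> ~~ inner v -> p v = 0) ->
    \sum_v p v * app Om w v = 0.
  move=> pb pi po; apply: test => v vS; rewrite app_subl app1.
  have va : v != a by move: vS; rewrite in_setU1 negb_or => /andP [].
  have [iv|iv] := boolP (inner v); first by rewrite appLi // -pi // subrr.
  rewrite appLo // subr0; have [->//|vb] := eqVneq v b; exact: po.
have w0 v : 0 <= w v.
  pose p u := Num.min (w u) 0.
  have pw u : p u <= w u by rewrite ge_min lexx.
  suff <- : p v = 0 by [].
  apply: (posdef_eq0 pOm).
  have pw0 : \sum_v p v * app Om w v = 0.
    apply: testE => [|u ua iu|u uS ub iu]; rewrite /p.
    - by rewrite wb; case: leP => //; rewrite ler10.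
    - by rewrite wi.
    - by rewrite wo // minxx.
  (* With [p <= 0], [w - p >= 0], off-diagonal entries of [Om] at most 0 and
     [p t * (w t - p t) = 0], the form of [Om] at [p] is at most the pairing of [p] with [Om w],
     which is 0. *)
  rewrite -[leRHS]pw0; apply: ler_sum => t _; rewrite -subr_ge0 -mulrBr -app_sub /app big_distrr.
  apply: sumr_ge0 => u _ /=.
  have [->|ut] := eqVneq u t.
    by rewrite mulrCA /p; case: (leP (w t) 0) => _; rewrite ?subrr ?mul0r !mulr0.
  apply: mulr_le0; first by rewrite ge_min lexx orbT.
  apply: mulr_le0_ge0; first by rewrite Omle // eq_sym.
  by rewrite subr_ge0.
have w_step u v : u \in A -> bi G u v -> w u = 0 -> w v = 0.
  (* [q] marks the zeros of [w] in [A]. The terms of its pairing with [Om w] are all at most 0 and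
     sum to 0, so each vanishes; the one at [u], [v] has a negative entry of [Om], which forces
     [w v = 0]. *)
  pose q t : R := ((t \in A) && (w t == 0))%:R.
  have q0 t s : 0 <= - (q t * (entry Om t s * w s)).
    rewrite -mulrN /q; case: andP => [[_ /eqP wt]|_]; last by rewrite mul0r.
    rewrite mul1r; have [<-|ts] := eqVneq t s; first by rewrite wt mulr0 oppr0.
    by rewrite oppr_ge0 mulr_le0_ge0 ?Omle.
  move=> uA uv wu; have : \sum_t q t * app Om w t = 0.
    apply: testE => [|t ta it|t tS tb it]; rewrite /q.
    - by rewrite wb oner_eq0 andbF.
    - case/andP: (it) => tA; rewrite in_setU1 negb_or => /andP [tb _].
      by rewrite wi // tA (nxtP t tA tb).1.
    - case: (boolP (t \in A)) => //= tA; case/negP: it.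
      move: tS; rewrite /inner !in_setU1 !negb_or => /andP [_ tS].
      by rewrite tA tb.
  move/eqP; rewrite -oppr_eq0 -sumrN => /eqP.
  under eq_bigr do rewrite /app big_distrr /= -sumrN.
  move/psumr_eq0P => /(_ (fun t _ => sumr_ge0 _ (fun s _ => q0 t s))) /(_ u isT).
  move/psumr_eq0P => /(_ (fun s _ => q0 u s)) /(_ v isT) /eqP.
  rewrite /q uA wu eqxx mul1r oppr_eq0 mulf_eq0 (lt_eqF (Omlt _ _ uv)) /=.
  by move/eqP.
exists w; split=> // d; rewrite inE lt0r w0 andbT => bd.
(* Zeros of [w] spread along bidirected edges in [A], so a zero in the district would reach [b],
   where [w] is 1. *)
have: b \notin [pred t | w t == 0] by rewrite inE wb oner_eq0.
rewrite (@closed_connect _ _ _ _ _ _ bd) // => u v /and3P [uA vA uv].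
rewrite !inE; apply/eqP/eqP; first exact: w_step uv.
by apply: (w_step v u vA); rewrite bi_sym.
Qed.

Lemma regression_identifiable_conditions a b : dir G a b ->
  regression_identifiable R G a b ->
  a \notin dis_in G (an G b) b /\
  ~ (exists2 d, d \in dis_in G (an G b) b :\ b & dir G a d).
Proof.
move=> ab [S Sab eqS]; split.
  apply/negP => aD.
  have [|//|w [wa _ /(_ a aD)]] := faithful_weights (k := fun=> 0) ab Sab eqS.
    by [].
  by rewrite wa big1 ?ltxx // => u _; rewrite mul0r.
case=> d /setD1P [db dD] ad.
have [u|/=|w [wa w0 wD]] := faithful_weights (k := fun u => - indic R d u) ab Sab eqS.
- rewrite /indic; case: eqP => [->|_ _]; first by rewrite ad.
  by rewrite oppr0.
- by rewrite /indic eq_sym (negPf db) oppr0.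
have := w0 a; rewrite wa (bigD1 d) //= big1 => [|u /negPf ud].
  by rewrite /indic eqxx mulN1r addr0 oppr_ge0 leNgt wD.
by rewrite /indic ud oppr0 mul0r.
Qed.

End Model.

Theorem theorem3p8 (R : realType) (V : finType) (G : admg V) (a b : V)
    (hab : dir G a b) :
  (regression_identifiable R G a b <->
     a \notin dis_in G (an G b) b /\
     ~ (exists2 d : V, d \in dis_in G (an G b) b :\ b & dir G a d)) /\
  (regression_identifiable R G a b ->
     equals_regr_coef R G a b (mb_in G (an G b) b :\ a)).
Proof.
have nec := @regression_identifiable_conditions R V G a b hab.
split; last by move/nec => [? ?]; apply: regr_coef_mb.
split=> // -[aD aN]; exists (mb_in G (an G b) b :\ a); last exact: regr_coef_mb.
(* [b] is outside its own blanket, since it has no child in its district. *)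
apply/subsetP => u /setD1P [ua /mb_in_anP uS]; rewrite !inE (negPf ua) /=.
case: uS => [[v vD]|[]] //; apply: contraTneq => ->.
by rewrite an_dirN // (dis_in_sub (an_self G b) vD).
Qed.
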